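(* Let $C$ be a linear code of length $n$ over $\mathbb{F}_q$ with $C\ne 0$, $C \neq \mathbb{F}_q^n$, with minimum distance $d \ge 2$ and dual minimum distance $d^\perp \ge 2$. Let $r = n+2-d-d^\perp$, let $P(T) = p_0 + p_1 T + \cdots + p_r T^r$ be the zeta polynomial of $C$, and let $g(w)$ be the difference polynomial of $C$ (both defined in the context). Then, as polynomials in $w$, $$g(w) = (q-1)\left( p_0 \binom{w-2}{d-2} - p_1 \binom{w-2}{d-1} + \cdots + (-1)^r p_r \binom{w-2}{d+r-2} \right).$$
   Context: $\mathbb{F}_q$ is the finite field with $q$ elements. A linear code of length $n$ is a linear subspace $C \subseteq \mathbb{F}_q^n$. Its minimum distance $d$ is the smallest weight (number of nonzero coordinates) of a nonzero codeword, and $d^\perp$ is the minimum distance of the dual code $C^\perp$ (orthogonal complement for the standard inner product). For $0\le w\le n$, $A_w$ is the number of codewords of weight $w$ and $a_w = A_w/\binom{n}{w}$. Zeta polynomial: put $a(t) = \frac{1}{q-1}(a_d + a_{d+1}t + \cdots + a_n t^{n-d})$. The zeta polynomial $P(T)$ of $C$ is the unique polynomial of degree at most $n-d$ (with rational coefficients) such that, as formal power series in $T$, $$\frac{P(T)}{(1-T)(1-qT)}(1-T)^{d+1} \equiv a\!\left(\frac{T}{1-T}\right) \pmod{T^{n-d+1}}.$$ When $d\ge 2$ and $d^\perp \ge 2$, it is known that $\deg P(T) = r = n+2-d-d^\perp$ and $P(1)=1$. Difference polynomial: $g(w)$ is the unique polynomial of degree $n-d^\perp$ with $g(w) = (a_w-(q-1)a_{w-1})(-1)^{w-d}$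 for $w=1,2,\ldots,n$ (such a polynomial exists and is unique). For an integer $m\ge 0$, $\binom{w-2}{m}$ denotes the polynomial $\frac{(w-2)(w-3)\cdots(w-1-m)}{m!}$ in $w$. *)

(* Defs.v *)
From HB Require Import structures.
From mathcomp Require Import all_boot all_order all_algebra.

Set Implicit Arguments.
Unset Strict Implicit.
Unset Printing Implicit Defensive.

Import Order.TTheory GRing.Theory Num.Theory.
Local Open Scope ring_scope.

(* A linear code of length n over F is C : {vspace 'rV[F]_n}. *)

Section Codes.
Variables (F : finFieldType) (n : nat).
Implicit Types (C : {vspace 'rV[F]_n}) (c x y : 'rV[F]_n).

Definition wt c : nat := #|[set i | c 0 i != 0]|.

Definition dual_code C : {vspace 'rV[F]_n} :=
  (\bigcap_(y in C) lker (linfun (mulmxr y^T : 'rV[F]_n -> 'M[F]_1)))%VS.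

Lemma mem_dual_code C x :
  reflect (forall y, y \in C -> \sum_i x 0 i * y 0 i = 0) (x \in dual_code C).
Proof.
apply: (iffP idP) => [xC y yC | xC].
  move: xC; rewrite memvE => /subv_bigcapP/(_ y yC).
  rewrite -memvE memv_ker lfunE /= => /eqP/matrixP/(_ 0 0).
  rewrite !mxE => h; rewrite -[RHS]h.
  by apply: eq_bigr => i _; rewrite mxE.
rewrite memvE; apply/subv_bigcapP => y yC.
rewrite -memvE memv_ker lfunE /=; apply/eqP/matrixP => i j.
rewrite !ord1 !mxE -[RHS](xC y yC).
by apply: eq_bigr => k _; rewrite mxE.
Qed.

(* Every weight is at most n, so the default value n of the empty minimum
   matters only when C = 0. *)
Definition min_dist C : nat := \big[minn/n]_(c in C | c != 0) wt c.

Lemma wt_le c : (wt c <= n)%N.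
Proof. by rewrite /wt -[X in (_ <= X)%N]card_ord max_card. Qed.

Lemma min_dist_le C c : c \in C -> c != 0 -> (min_dist C <= wt c)%N.
Proof.
move=> cC c0; rewrite /min_dist; move: (mem_index_enum c).
elim: (index_enum _) => //= e s IHs; rewrite inE big_cons => /predU1P[<-|cs].
  by rewrite cC c0 geq_minl.
by case: ifP => _; [apply: leq_trans (geq_minr _ _) (IHs cs) | exact: IHs].
Qed.

Lemma min_dist_attained C :
  C != 0%VS -> exists c, [/\ c \in C, c != 0 & wt c = min_dist C].
Proof.
move=> C0; have vC : vpick C \in C by rewrite memv_pick.
have v0 : vpick C != 0 by rewrite vpick0.
case: (@arg_minnP _ (vpick C) [pred c | (c \in C) && (c != 0)] wt).
  by rewrite /= vC v0.
move=> c /andP[cC c0] cmin; exists c; split=> //; apply/eqP.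
rewrite eqn_leq min_dist_le // andbT /min_dist.
apply: (big_ind (fun m => wt c <= m)%N) => [|a b|e eC]; first exact: wt_le.
  by rewrite leq_min => -> ->.
exact: cmin.
Qed.

Definition weight_count C (w : nat) : nat := #|[set c in C | wt c == w]|.

Definition weight_ratio C (w : nat) : rat :=
  (weight_count C w)%:R / 'C(n, w)%:R.

End Codes.

(* A formal power series over R is its coefficient sequence nat -> R. *)
Section PowerSeries.
Variable R : comNzRingType.
Implicit Types (f g : nat -> R) (p : {poly R}).

Definition fps_poly p : nat -> R := fun i => p`_i.

Definition fps_mul f g : nat -> R :=
  fun m => \sum_(i < m.+1) f i * g (m - i)%N.

Definition fps_exp f (k : nat) : nat -> R := iter k (fps_mul f) (fps_poly 1).

(* The series 1 / (1 - c T); see fps_geomP. *)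
Definition fps_geom (c : R) : nat -> R := fun i => c ^+ i.

Lemma fps_geomP (c : R) :
  fps_mul (fps_poly (1 - c *: 'X)) (fps_geom c) =1 fps_poly 1.
Proof.
case=> [|m]; rewrite /fps_mul /fps_poly /fps_geom.
  by rewrite big_ord1 /= coefB coefZ coefX !coef1 mulr0 subr0 mulr1.
rewrite 2!big_ord_recl big1 => [|i _]; last first.
  by rewrite coefB coefZ coefX coef1 /= mulr0 subr0 mul0r.
rewrite !coefB !coefZ !coefX !coef1 /= mulr0 subr0 sub0r !mulr1 mul1r addr0.
by rewrite subn0 /bump /= subSS subn0 exprS mulNr subrr.
Qed.

(* Substitution p(f); a finite sum, since p is a polynomial. *)
Definition fps_subst p f : nat -> R :=
  fun m => \sum_(j < size p) p`_j * fps_exp f j m.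

Definition fps_eqmod (N : nat) f g : Prop :=
  forall i : nat, (i < N)%N -> f i = g i.

End PowerSeries.

Section ZetaAndDifference.
Variables (F : finFieldType) (n : nat).
Implicit Types (C : {vspace 'rV[F]_n}) (P g : {poly rat}).

Definition weight_poly C : {poly rat} :=
  let d := min_dist C in
  (#|F|%:R - 1)^-1 *: \poly_(i < (n - d).+1) weight_ratio C (d + i).

Definition is_zeta_poly C P : Prop :=
  let d := min_dist C in
  let q : rat := #|F|%:R in
  (size P <= (n - d).+1)%N /\
  fps_eqmod (n - d).+1
    (fps_mul (fps_mul (fps_poly P) (fps_mul (fps_geom 1) (fps_geom q)))
             (fps_exp (fps_poly (1 - 'X)) d.+1))
    (fps_subst (weight_poly C) (fps_mul (fps_poly 'X) (fps_geom 1))).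

(* The exponent w - d is an integer, negative for w < d. *)
Definition is_difference_poly C g : Prop :=
  let d := min_dist C in
  let q : rat := #|F|%:R in
  size g = (n - min_dist (dual_code C)).+1 /\
  forall w : nat, (1 <= w <= n)%N ->
    g.[w%:R] = (weight_ratio C w - (q - 1) * weight_ratio C w.-1)
               * (-1) ^ (w%:Z - d%:Z).

End ZetaAndDifference.

(* The polynomial binom(w - 2, m) in the variable w = 'X. *)
Definition binom_sub2 (m : nat) : {poly rat} :=
  (m`!%:R)^-1 *: \prod_(2 <= j < m.+2) ('X - j%:R%:P).

(* Main.v *)
(* Put x = T / (1 - T), so that 1 + x = 1 / (1 - T) and
   1 - q T = (1 - T) (1 - (q - 1) x).  Modulo x^(n-d+1), the definition of the
   zeta polynomial becomes
     \sum_i p_i x^i (1 + x)^(1 - d - i) = (1 - (q - 1) x) a(x),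
   and the negative binomial series turns the coefficient of x^(w-d) into the
   claimed identity at every w = d .. n, for the sum over all i <= n - d.  At
   w = 2 .. d - 1 both sides vanish.  Both sides have degree at most n - 2, so
   these n - 1 points determine them.  Since binom(w - 2, m) has degree m and g
   has degree n - d', the equality also forces p_i = 0 for i > r. *)
Require Import Defs.
From mathcomp Require Import all_boot all_order all_algebra.
From mathcomp Require Import ring zify.

Set Implicit Arguments.
Unset Strict Implicit.
Unset Printing Implicit Defensive.

Import Order.TTheory GRing.Theory Num.Theory.
Local Open Scope ring_scope.

(** * Evaluation of power series at a nilpotent element *)

Section NilpotentEvaluation.
Variables (K : comNzRingType) (A : comAlgType K) (N : nat).
Implicit Types (t : A) (f g : nat -> K) (p : {poly K}).

(* Substituting t for the variable is a ring morphism on power series only when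
   t ^+ N = 0. *)
Definition fps_eval t f : A := horner_alg t (\poly_(i < N) f i).

Lemma fps_eval_eqmod t f g : fps_eqmod N f g -> fps_eval t f = fps_eval t g.
Proof. by move=> fg; congr horner_alg; apply: eq_poly. Qed.

Lemma horner_algZX t c : horner_alg t (c *: 'X : {poly K}) = c *: t.
Proof. by rewrite -mul_polyC rmorphM /= horner_algC horner_algX mulr_algl. Qed.

Lemma fps_eval_sum t M (c : nat -> K) (F : nat -> nat -> K) :
  fps_eval t (fun m => \sum_(j < M) c j * F j m) =
  \sum_(j < M) c j *: fps_eval t (F j).
Proof.
transitivity (horner_alg t (\sum_(j < M) c j *: \poly_(m < N) F j m)).
  congr horner_alg; apply/polyP => m; rewrite coef_poly coef_sum.
  case: ifP => mN; last first.
    by rewrite big1 // => j _; rewrite coefZ coef_poly mN mulr0.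
  by apply: eq_bigr => j _; rewrite coefZ coef_poly mN.
by rewrite linear_sum; apply: eq_bigr => j _; rewrite linearZ /= mulr_algl.
Qed.

Section Nilpotent.
Variable t : A.
Hypothesis tN : t ^+ N = 0.

(** The part of [p] cut off by the truncation is a multiple of ['X^N], which vanishes at [t]. *)
Lemma fps_eval_poly p : fps_eval t (fps_poly p) = horner_alg t p.
Proof.
rewrite /fps_eval -[in RHS](poly_take_drop N p) rmorphD rmorphM rmorphXn /=.
by rewrite horner_algX tN mulr0 addr0.
Qed.

Lemma fps_evalM f g : fps_eval t (fps_mul f g) = fps_eval t f * fps_eval t g.
Proof.
rewrite [fps_eval t f]/fps_eval [fps_eval t g]/fps_eval -rmorphM /=.
rewrite -fps_eval_poly; apply: fps_eval_eqmod => m mN.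
rewrite /fps_mul /fps_poly coefM; apply: eq_bigr => i _.
have := ltn_ord i; rewrite ltnS => im.
by rewrite !coef_poly (leq_ltn_trans im mN) (leq_ltn_trans (leq_subr _ _) mN).
Qed.

Lemma fps_eval_exp f k : fps_eval t (fps_exp f k) = fps_eval t f ^+ k.
Proof.
elim: k => [|k IHk] /=; first by rewrite fps_eval_poly rmorph1.
by rewrite fps_evalM IHk exprS.
Qed.

Lemma fps_eval_geom c : (1 - c *: t) * fps_eval t (fps_geom c) = 1.
Proof.
have := fps_eval_eqmod t (fun i _ => fps_geomP c i).
by rewrite fps_evalM !fps_eval_poly rmorphB !rmorph1 /= horner_algZX.
Qed.

Lemma fps_eval_subst p f :
  fps_eval t (fps_subst p f) = horner_alg (fps_eval t f) p.
Proof.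
rewrite fps_eval_sum -[in RHS](coefK p) poly_def linear_sum.
apply: eq_bigr => j _ /=.
by rewrite linearZ rmorphXn /= horner_algX -fps_eval_exp mulr_algl.
Qed.

(* The series 1 / (1 + T)^(k+1). *)
Definition fps_negbin (k : nat) : nat -> K :=
  fun l => (-1) ^+ l * 'C(k + l, l)%:R.

Lemma fps_negbin0 : fps_negbin 0 =1 fps_geom (-1).
Proof. by move=> l; rewrite /fps_negbin add0n binn mulr1. Qed.

(** Pascal's rule with alternating signs. *)
Lemma fps_negbinS k :
  fps_mul (fps_poly (1 + 'X)) (fps_negbin k.+1) =1 fps_negbin k.
Proof.
case=> [|m]; rewrite /fps_mul /fps_poly /fps_negbin.
  by rewrite big_ord1 coefD coefX coef1 !addn0 !bin0 addr0 !mul1r.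
rewrite 2!big_ord_recl big1 => [|i _]; last first.
  by rewrite coefD coefX coef1 /= addr0 mul0r.
rewrite !coefD !coefX !coef1 /= addr0 add0r subn0 /bump /= subSS subn0 !mul1r.
rewrite addr0 addSn binS (addSnnS k m) natrD exprS; ring.
Qed.

Lemma fps_eval_negbin k : (1 + t) ^+ k.+1 * fps_eval t (fps_negbin k) = 1.
Proof.
elim: k => [|k IHk].
  rewrite (fps_eval_eqmod t (fun i _ => fps_negbin0 i)) expr1.
  by have := fps_eval_geom (-1); rewrite scaleN1r opprK.
rewrite exprSr -mulrA -[RHS]IHk; congr (_ * _).
rewrite -(fps_eval_eqmod t (fun i _ => fps_negbinS k i)) fps_evalM.
by rewrite fps_eval_poly rmorphD rmorph1 /= horner_algX.
Qed.

End Nilpotent.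
End NilpotentEvaluation.

(** * The zeta congruence, coefficient by coefficient in x *)

Section ZetaCoefficients.
Variables (K : comNzRingType) (N : nat).
Implicit Types (f g : nat -> K) (p : {poly K}).

(* The ring of polynomials in x modulo x^(N+1); T is sent to x / (1 + x). *)
Let A := {poly %/ ('X^(N.+1) : {poly K})}.
Let x : A := in_qpoly 'X^(N.+1) 'X.

Lemma mk_monicXS : mk_monic ('X^(N.+1) : {poly K}) = 'X^(N.+1).
Proof. by rewrite mk_monic_Xn. Qed.

Lemma qpolyX_nilp : x ^+ N.+1 = 0.
Proof.
rewrite -rmorphXn; apply: val_inj => /=.
by rewrite mk_monicXS Pdiv.RingMonic.rmodpp // monicXn.
Qed.

Lemma horner_alg_qpolyX p : horner_alg x p = in_qpoly 'X^(N.+1) p.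
Proof. by rewrite -(poly_alg_initial (in_qpoly 'X^(N.+1))). Qed.

(** A polynomial of degree at most N is its own remainder modulo ['X^(N.+1)], so identities proved
    in [A] can be read off on coefficients. *)
Lemma fps_eval_qpolyX_inj f g :
  fps_eval N.+1 x f = fps_eval N.+1 x g -> fps_eqmod N.+1 f g.
Proof.
rewrite /fps_eval !horner_alg_qpolyX => /(congr1 val) /=.
rewrite !Pdiv.Ring.rmodp_small ?mk_monicXS ?size_polyXn ?ltnS ?size_poly //.
move=> fg i iN; have /(congr1 (fun p : {poly K} => p`_i)) := fg.
by rewrite !coef_poly iN.
Qed.

(** Used with N = n - d and e = d - 2, so that [e.+3] is the exponent d + 1. *)
Lemma zeta_coef (P a : {poly K}) (q : K) (e : nat) :
  fps_eqmod N.+1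
    (fps_mul (fps_mul (fps_poly P) (fps_mul (fps_geom 1) (fps_geom q)))
             (fps_exp (fps_poly (1 - 'X)) e.+3))
    (fps_subst a (fps_mul (fps_poly 'X) (fps_geom 1))) ->
  forall j, (j < N.+1)%N ->
  \sum_(i < N.+1) P`_i * ((-1) ^+ (i + j) * 'C(e + j, e + i)%:R) =
  ((1 - (q - 1) *: 'X) * a)`_j.
Proof.
move=> Pa.
(* [B k] is the series x^k (1 + x)^-(e+k+1). Its binomial vanishes for j < k, and (-1)^(k+j) is
   (-1)^(j-k) without a subtraction. *)
pose B k : nat -> K := fun j => (-1) ^+ (k + j) * 'C(e + j, e + k)%:R.
suff: fps_eqmod N.+1 (fun j => \sum_(i < N.+1) P`_i * B i j)
        (fps_poly ((1 - (q - 1) *: 'X) * a)) by [].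
apply: fps_eval_qpolyX_inj; have xN := qpolyX_nilp.
set u := fps_eval N.+1 x (fps_negbin K 0).
have uE : (1 + x) * u = 1 by rewrite -[1 + x]expr1 fps_eval_negbin.
have BE i : fps_eval N.+1 x (B i) = x ^+ i * u ^+ (e + i).+1.
  transitivity (fps_eval N.+1 x
      (fps_mul (fps_poly 'X^i) (fps_negbin K (e + i)))).
    apply: fps_eval_eqmod => j _; rewrite /B /fps_mul /fps_poly.
    case: (leqP i j) => [le_ij | lt_ji]; last first.
      rewrite bin_small ?mulr0 ?ltn_add2l // big1 // => k _.
      rewrite coefXn; case: eqP => [ki|]; rewrite ?mul0r //.
      by have := ltn_ord k; rewrite ki ltnS leqNgt lt_ji.
    have ij : (i < j.+1)%N by [].
    rewrite (bigD1 (Ordinal ij)) //= coefXn eqxx mul1r big1 ?addr0 => [|k ki].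
      have le_ji : (j - i <= e + j)%N by lia.
      rewrite /fps_negbin -addnA subnKC // -[in RHS](bin_sub le_ji).
      rewrite (_ : e + j - (j - i) = e + i)%N; last lia.
      have -> : (i + j = j - i + 2 * i)%N by lia.
      by rewrite exprD exprM sqrrN expr1n expr1n mulr1.
    rewrite coefXn (_ : (_ == _) = false) ?mul0r //.
    by apply: contra_neqF ki => /eqP ki; apply: val_inj.
  rewrite fps_evalM // fps_eval_poly // rmorphXn /= horner_algX; congr (_ * _).
  rewrite -[RHS]mulr1 -(fps_eval_negbin xN (e + i)) mulrA -exprMn (mulrC u) uE.
  by rewrite expr1n mul1r.
rewrite fps_eval_sum fps_eval_poly //.
(* As [u] inverts 1 + x, [t] is the value x / (1 + x) of T. It is nilpotent because x is, so the
   hypothesis can be evaluated there. *)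
pose t := x * u.
have tN : t ^+ N.+1 = 0 by rewrite exprMn xN mul0r.
have tE : 1 - t = u by rewrite -uE /t; ring.
have := fps_eval_eqmod t Pa; rewrite fps_eval_subst // !(fps_evalM tN).
rewrite (fps_eval_exp tN) !(fps_eval_poly tN).
have := fps_eval_geom tN 1; have := fps_eval_geom tN q.
rewrite rmorphB rmorph1 /= horner_algX.
rewrite scale1r tE; set V := fps_eval _ t (fps_geom 1).
set W := fps_eval _ t (fps_geom q) => WE VE.
have {VE} -> : V = 1 + x.
  transitivity ((1 + x) * u * V); first by rewrite uE mul1r.
  by rewrite -mulrA VE mulr1.
rewrite (_ : t * (1 + x) = x); last by rewrite /t -mulrA (mulrC u) uE mulr1.
have lin : 1 - (q - 1) *: x = (1 + x) * (1 - q *: t).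
  rewrite mulrBr -scalerAr /t mulrCA uE mulr1 mulr1 scalerBl scale1r opprB.
  by rewrite addrA.
rewrite rmorphM rmorphB rmorph1 /= horner_algZX lin => <-.
transitivity (horner_alg t P * u ^+ e.+1).
  rewrite -(fps_eval_poly tN) [fps_eval _ t _]/fps_eval poly_def linear_sum.
  rewrite mulr_suml.
  apply: eq_bigr => i _; rewrite BE linearZ rmorphXn /= horner_algX mulr_algl.
  by rewrite -scalerAl /t exprMn -mulrA -exprD addnS addnC.
(* The inserted factors equal 1. They turn u^(e+1) into the u^(e+3) of the hypothesis and supply
   both factors 1 + x, one from 1 / (1 - t) and one from [lin]. *)
transitivity (horner_alg t P * u ^+ e.+1 * ((1 + x) * u) ^+ 2 *
                 ((1 - q *: t) * W)).
  by rewrite uE WE expr1n !mulr1.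
by rewrite (exprS u); ring.
Qed.

End ZetaCoefficients.

(** * Binomial polynomials and weight ratios *)

Lemma size_binom_sub2 m : size (binom_sub2 m) = m.+1.
Proof.
rewrite size_scale ?invr_eq0 ?pnatr_eq0 -?lt0n ?fact_gt0 //.
by rewrite size_prod_XsubC size_iota !subSS subn0.
Qed.

Lemma horner_binom_sub2 m w : (binom_sub2 m).[w.+2%:R] = 'C(w, m)%:R.
Proof.
have prodE : (\prod_(2 <= j < m.+2) ('X - j%:R%:P)).[w.+2%:R]
    = (w ^_ m)%:R :> rat.
  elim: m => [|m IHm]; first by rewrite big_geq // hornerC.
  rewrite big_nat_recr //= hornerM {}IHm hornerXsubC ffactnSr natrM.
  (* The truncated w - m is the rational difference only for m <= w; beyond that the falling
     factorial is already 0. *)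
  case: (leqP m w) => [le_mw | lt_wm]; last by rewrite ffact_small ?mul0r.
  by rewrite -natrB ?subSS.
rewrite hornerZ prodE -bin_ffact natrM mulrC mulfK //.
by rewrite pnatr_eq0 -lt0n fact_gt0.
Qed.

Lemma sum_coef_widen (K : nzRingType) (V : lmodType K) (P : {poly K})
    (c : nat -> K) (F : nat -> V) N :
  (size P <= N)%N ->
  \sum_(i < N) (c i * P`_i) *: F i = \sum_(i < size P) (c i * P`_i) *: F i.
Proof.
move=> PN; rewrite -(subnKC PN) big_split_ord /= [X in _ + X]big1 ?addr0 //.
by move=> i _; rewrite nth_default ?leq_addr // mulr0 scale0r.
Qed.

(** The binomials have distinct degrees e + i, so the leading coefficient of [P] decides and nothing
    cancels it. *)
Lemma size_sum_binom_sub2 (P : {poly rat}) (c : nat -> rat) e :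
  P != 0 -> (forall i, c i != 0) ->
  size (\sum_(i < size P) (c i * P`_i) *: binom_sub2 (e + i)) = (e + size P)%N.
Proof.
move=> P0 c0; have := lead_coef_eq0 P; rewrite lead_coefE (negPf P0).
rewrite (polySpred P0) /= => Pk.
have ck : c (size P).-1 * P`_(size P).-1 != 0 by rewrite mulf_neq0 ?Pk.
rewrite big_ord_recr /= addrC size_polyDl size_scale ?size_binom_sub2 ?addnS //.
rewrite ltnS (leq_trans (size_sum _ _ _)) //; apply/bigmax_leqP => i _.
by rewrite (leq_trans (size_scale_leq _ _)) // size_binom_sub2 ltn_add2l.
Qed.

Lemma weight_ratio_eq0 (F : finFieldType) (n : nat) (C : {vspace 'rV[F]_n}) w :
  (0 < w < min_dist C)%N -> weight_ratio C w = 0.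
Proof.
case/andP=> w0 wd; rewrite /weight_ratio (_ : weight_count C w = 0%N) ?mul0r //.
apply/eqP; rewrite cards_eq0; apply/eqP/setP => c; rewrite !inE.
apply/negP => /andP[cC /eqP cw]; have /(min_dist_le cC) : c != 0.
  apply: contraTneq w0 => c0; rewrite -cw c0 /wt -leqNgt leqn0 cards_eq0.
  by apply/eqP/setP => i; rewrite !inE mxE eqxx.
by rewrite cw leqNgt wd.
Qed.

Lemma weight_poly_coef (F : finFieldType) (n : nat) (C : {vspace 'rV[F]_n}) j :
  let q : rat := #|F|%:R in
  (2 <= min_dist C)%N -> (j < (n - min_dist C).+1)%N ->
  (q - 1) * ((1 - (q - 1) *: 'X) * weight_poly C)`_j =
  weight_ratio C (min_dist C + j)
  - (q - 1) * weight_ratio C (min_dist C + j).-1.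
Proof.
move=> q; set d := min_dist C => d2 jn.
have q1 : q - 1 != 0.
  by rewrite subr_eq0 pnatr_eq1; apply: contraTneq (card_finNzRing_gt1 F) => ->.
have wE i : (i <= n - d)%N ->
    (q - 1) * (weight_poly C)`_i = weight_ratio C (d + i).
  by move=> le_i; rewrite coefZ coef_poly ltnS le_i mulrA mulfV ?mul1r.
rewrite (mulrBl (weight_poly C)) mul1r -scalerAl coefB (coefZ (q - 1)).
rewrite coefXM mulrBr wE //.
case: j jn => [|j] jn /=; last by rewrite mulrCA wE ?addnS //; lia.
(* At j = 0 the term a_(d-1) must vanish; d >= 2 keeps its index away from 0, where the zero
   codeword counts. *)
by rewrite !mulr0 addn0 (@weight_ratio_eq0 _ _ _ d.-1) ?mulr0 //; lia.
Qed.

Theorem proposition1 (F : finFieldType) (n : nat) (C : {vspace 'rV[F]_n})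
    (P g : {poly rat}) :
  let q : rat := #|F|%:R in
  let d := min_dist C in
  let d' := min_dist (dual_code C) in
  let r := (n + 2 - d - d')%N in
  C != 0%VS -> C != fullv ->
  (2 <= d)%N -> (2 <= d')%N ->
  is_zeta_poly C P ->
  is_difference_poly C g ->
  g = (q - 1) *:
      \sum_(i < r.+1) ((-1) ^+ i * P`_i) *: binom_sub2 (d + i - 2).
Proof.
move=> q d d' r C0 _ d2 d'2 [sP zP] [sg gE]; rewrite -/d -/d' -/q in sP sg gE.
have dn : (d <= n)%N.
  by rewrite /d; have [c [_ _ <-]] := min_dist_attained C0; apply: wt_le.
pose e := (d - 2)%N; have de : d = e.+2 by rewrite /e; lia.
rewrite -/d -/q {2}de in zP.
have q1 : q - 1 != 0.
  by rewrite subr_eq0 pnatr_eq1; apply: contraTneq (card_finNzRing_gt1 F) => ->.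
pose B i := binom_sub2 (e + i).
rewrite (eq_bigr (fun i : 'I_r.+1 => ((-1) ^+ i * P`_i) *: B i)); last first.
  by move=> i _; rewrite /B; congr (_ *: binom_sub2 _); lia.
(* The sum first runs over all degrees that [is_zeta_poly] allows; the bound r comes from comparing
   degrees once g = G is known. *)
pose G := (q - 1) *: \sum_(i < (n - d).+1) ((-1) ^+ i * P`_i) *: B i.
have sizeG : P != 0 -> size G = (e + size P)%N.
  move=> P0; rewrite size_scale // (sum_coef_widen _ _ sP).
  by rewrite size_sum_binom_sub2 // => i; rewrite signr_eq0.
have gG : g = G.
  apply/eqP; rewrite -subr_eq0; apply/eqP.
  (* The roots are 2 .. n. Both sizes are at most n - 1: that of g since d' >= 2, that of G since e
     + (n - d) + 1 = n - 1. *)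
  apply: (@roots_geq_poly_eq0 _ _ [seq w.+2%:R | w <- iota 0 n.-1]).
  - apply/allP => x /mapP[w]; rewrite mem_iota add0n => /andP[_ wn] -> {x}.
    rewrite rootE hornerD hornerN subr_eq0 gE; last by lia.
    rewrite hornerZ horner_sum.
    under eq_bigr do rewrite hornerZ horner_binom_sub2.
    (* For w < e the weights w + 1 and w + 2 lie strictly between 0 and d, and every 'C(w, e + i) is
       0. *)
    case: (ltnP w e) => [lt_we | le_ew].
      rewrite !weight_ratio_eq0 -/d ?de ?mulr0 ?subr0 ?mul0r; try lia.
      by rewrite big1 ?mulr0 // => i _; rewrite bin_small ?mulr0 //; lia.
    have [j wE] : exists j, w = (e + j)%N by exists (w - e)%N; lia.
    move: wn; rewrite wE => wn.
    have jn : (j < (n - d).+1)%N by lia.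
    rewrite (_ : (e + j).+2 = d + j)%N; last by rewrite de.
    rewrite -weight_poly_coef // PoszD addrAC subrr add0r -/q -mulrA.
    apply/eqP; rewrite -(zeta_coef zP jn) mulr_suml; congr (_ * _).
    apply: eq_bigr => i _; rewrite -exprnP exprD.
    (* One (-1)^j comes from the sign in g, at w - d = j, the other from [zeta_coef]. *)
    transitivity ((-1) ^+ i * P`_i * 'C(e + j, e + i)%:R * ((-1) ^+ j) ^+ 2).
      by ring.
    by rewrite sqrr_sign mulr1.
  - rewrite map_inj_uniq ?iota_uniq // => i j /eqP.
    by rewrite eqr_nat => /eqP[].
  rewrite size_map size_iota (leq_trans (size_polyD _ _)) // size_polyN geq_max.
  rewrite sg; apply/andP; split; first lia.
  have [P0 | P0] := eqVneq P 0.
    rewrite /G big1 ?scaler0 ?size_poly0 // => i _.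
    by rewrite P0 coef0 mulr0 scale0r.
  by rewrite sizeG //; lia.
(* For nonzero [P], equal sizes of g and G give e + size P = n - d' + 1. *)
have sPr : (size P <= r.+1)%N.
  have [-> | P0] := eqVneq P 0; first by rewrite size_poly0.
  by have := sizeG P0; rewrite -gG sg /r; lia.
by rewrite gG /G !sum_coef_widen.
Qed.
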